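(* Let $d>d_c$, $\theta(d)>2$, $p^*\ge1$, and assume that the family $(f_n,g_n,e_n)$ satisfies Assumptions $S$, $D$, $E_\theta$ and $G_\theta$ formulated in the context. Let $L$ be sufficiently large, and let $z_c=z_c(d,L)$ be the critical value defined in the context. Suppose there is a $z_c'>0$ such that the susceptibility $$\chi(z)=\sum_{n=0}^\infty f_n(0;z)$$ is absolutely convergent for $z\in(0,z_c')$, with $\lim_{z\uparrow z_c'}\chi(z)=\infty$ (if $\chi(z)$ is a power series in $z$ then $z_c'$ is the radius of convergence of $\chi(z)$). Suppose also that the bounds (F) of the context, for $z=z_c$ and all $m\ge1$, imply the bounds on $e_m(k;z)$ and $g_m(k;z)$ appearing in the conclusions of Assumptions $E_\theta$ and $G_\theta$ for all $m\ge2$, uniformly in $z\in[0,z_c]$. Then $z_c=z_c'$.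
   Context: **Setting.** $x\wedge y=\min\{x,y\}$. $d$ is a positive integer (dimension), $d_c$ is a fixed model-dependent number (the critical dimension), $d>d_c$; $\theta=\theta(d)>2$ is a model-dependent parameter; $p^*\ge1$ and a nonempty set $B\subset[1,p^*]$ are fixed. $L\ge1$ is a parameter, to be taken large, and $\beta=\beta(p^* )=L^{-d/p^*}$. For each $L$ there are given functions $f_n(k;z)$ ($n\ge0$), $g_n(k;z)$, $e_n(k;z)$ ($n\ge1$) of $k\in[-\pi,\pi]^d$ and of the positive parameter $z$ (dependence on $L$ suppressed; where $z=0$ is mentioned the functions are understood to be defined there too), with $f_0(k;z)=1$ and, for $n\ge0$, $$f_{n+1}(k;z)=\sum_{m=1}^{n+1}g_m(k;z)f_{n+1-m}(k;z)+e_{n+1}(k;z).$$ $D=D_L$ is a function on $\mathbb{Z}^d$, $\hat D(k)=\sum_x e^{ik\cdot x}D(x)$, $a(k)=a_L(k)=1-\hat D(k)$, and $\sigma^2=\sigma_L^2=-\nabla^2\hat D(0)=\sum_x|x|^2D(x)$. $\nabla^2$ is the Laplacian in $k$, $k^2=|k|^2$ for the Euclidean norm, $\|k\|_\infty=\max_i|k_i|$, and for functions on $[-\pi,\pi]^d$, $\|h\|_p=\big(\int_{[-\pi,\pi]^d}|h(k)|^p\frac{d^dk}{(2\pi)^d}\big)^{1/p}$; $\hat D^2f$ denotes $\hat D(k)^2f(k)$. **Assumption $S$.** For every $n\in\mathbb{N}$ and $z>0$, $k\mapsto f_n(k;z)$ is symmetric under replacement of any component $k_i$ by $-k_i$ and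 under permutations of the components of $k$; the same holds for $e_n(\cdot;z)$ and $g_n(\cdot;z)$. For each $n$, $|f_n(k;z)|$ is bounded uniformly in $k\in[-\pi,\pi]^d$ and $z$ in a neighbourhood of $1$ (which may depend on $n$). $f_n$ and $g_n$ have continuous second derivatives (in $k$) in a neighbourhood of $0$ for every $n$. **Assumption $D$.** $D(x)\ge0$, $f_1(k;z)=z\hat D(k)$, $e_1(k;z)=0$ (so $g_1(k;z)=z\hat D(k)$). Moreover: (i) $\hat D(0)=1$ and, for some $\epsilon\in(0,\theta-2)$, $\sum_x|x|^{2+2\epsilon}D(x)<\infty$; (ii) there is a constant $C$ such that for all $L\ge1$, $\|D_L\|_\infty\le CL^{-d}$ and $\sigma_L^2\le CL^2$; (iii) there are constants $\eta,c_1,c_2>0$ (independent of $L$) with $c_1L^2k^2\le a_L(k)\le c_2L^2k^2$ for $\|k\|_\infty\le L^{-1}$, $a_L(k)>\eta$ for $\|k\|_\infty\ge L^{-1}$, and $a_L(k)<2-\eta$ for $k\in[-\pi,\pi]^d$. **Bounds (F).** For $m\ge1$, $z>0$ and a positive constant $K$, the bounds (F) are: for every $p\in B$, $$\|\hat D^2f_m(\cdot;z)\|_p\le\frac{K}{L^{d/p}m^{\frac{d}{2p}\wedge\theta}},\quad|f_m(0;z)|\le K,\quad|\nabla^2f_m(0;z)|\le K\sigma^2m.$$ **Assumption $E_\theta$.** There are $L_0$, an interval $I\subset[1-\alpha,1+\alpha]$ with $\alpha\in(0,1)$, and a function $K\mapsto C_e(K)$, such that if (F) holds for some $K>1$, $L\ge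 L_0$, $z\in I$ and for all $1\le m\le n$, then for that $L$ and $z$, all $k\in[-\pi,\pi]^d$ and all $2\le m\le n+1$, $$|e_m(k;z)|\le C_e(K)\beta m^{-\theta},\qquad|e_m(k;z)-e_m(0;z)|\le C_e(K)a(k)\beta m^{-\theta+1}.$$ **Assumption $G_\theta$.** There are $L_0$, an interval $I\subset[1-\alpha,1+\alpha]$ with $\alpha\in(0,1)$, and a function $K\mapsto C_g(K)$, such that if (F) holds for some $K>1$, $L\ge L_0$, $z\in I$ and for all $1\le m\le n$, then for that $L$ and $z$, all $k\in[-\pi,\pi]^d$ and all $2\le m\le n+1$, $$|g_m(k;z)|\le C_g(K)\beta m^{-\theta},\quad|\nabla^2g_m(0;z)|\le C_g(K)\sigma^2\beta m^{-\theta+1},\quad|\partial_zg_m(0;z)|\le C_g(K)\beta m^{-\theta+1},$$ $$|g_m(k;z)-g_m(0;z)-a(k)\sigma^{-2}\nabla^2g_m(0;z)|\le C_g(K)\beta a(k)^{1+\epsilon'}m^{-\theta+(1+\epsilon')},$$ the last bound for any $\epsilon'\in[0,\epsilon]$. **The critical value $z_c$.** Under these assumptions and for $L$ sufficiently large, define $z_0=z_1=1$ and $z_{n+1}=1-\sum_{m=2}^{n+1}g_m(0;z_n)$ for $n\ge1$. With a suitable constant $K_1$ independent of $\beta$, the intervals $I_n=[z_n-K_1\beta n^{-\theta+1},z_n+K_1\beta n^{-\theta+1}]$ are decreasing in $n$, and $z_c$ is the unique point of $\bigcap_{n\ge1}I_n$, i.e. $z_c=\lim_{n\to\infty}z_n$.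 It obeys $1=\sum_{m=1}^\infty g_m(0;z_c)$, and there is a constant $A=A(d,L)>0$ with $f_n(0;z_c)\to A$ as $n\to\infty$; moreover the bounds (F) hold at $z=z_c$ for all $m\ge1$, with some $K$ independent of $m$ and $L$. *)

(* Defs.v *)
From HB Require Import structures.
From mathcomp Require Import all_boot all_order all_algebra.
From mathcomp Require Import all_classical all_reals all_analysis.
From mathcomp Require Import complex.
From mathcomp Require Import fingroup perm.

Set Implicit Arguments.
Unset Strict Implicit.
Unset Printing Implicit Defensive.

Import Order.TTheory GRing.Theory Num.Theory.
Import numFieldNormedType.Exports.

Local Open Scope classical_set_scope.
Local Open Scope ring_scope.

Section Momentum.
Context {R : realType}.

(* The norm of 'rV[R]_d in the library is the sup norm; the Euclidean one is
   only needed squared on momenta, and on lattice points. *)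
Definition box (d : nat) : set 'rV[R]_d :=
  [set k | forall i, - pi <= k ord0 i <= pi].

Definition sqn (d : nat) (k : 'rV[R]_d) : R := \sum_i k ord0 i ^+ 2.

Definition sqnZ (d : nat) (x : 'rV[int]_d) : R := \sum_i (x ord0 i)%:~R ^+ 2.

Definition dotZ (d : nat) (k : 'rV[R]_d) (x : 'rV[int]_d) : R :=
  \sum_i k ord0 i * (x ord0 i)%:~R.

Definition evec (d : nat) (i : 'I_d) : 'rV[R]_d := delta_mx ord0 i.

Definition laplacian (d : nat) (h : 'rV[R]_d -> R) (k : 'rV[R]_d) : R :=
  \sum_i 'D_(evec i) ('D_(evec i) h) k.

(* Continuity of all second partials near 0 entails that of h and of its first
   partials there, so this is the usual C^2 condition. *)
Definition C2_near0 (d : nat) (h : 'rV[R]_d -> R) : Prop :=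
  \forall k \near (0 : 'rV[R]_d), forall i j : 'I_d,
    [/\ derivable h k (evec i),
        derivable ('D_(evec i) h) k (evec j)
      & {for k, continuous ('D_(evec j) ('D_(evec i) h))}].

Definition flip (d : nat) (i : 'I_d) (k : 'rV[R]_d) : 'rV[R]_d :=
  \row_j (if j == i then - k ord0 j else k ord0 j).

Definition lattice_symmetric (d : nat) (h : 'rV[R]_d -> R) : Prop :=
  (forall k i, box k -> h (flip i k) = h k) /\
  (forall k (s : 'S_d), box k -> h (col_perm s k) = h k).

Lemma ltNpipi : - pi < pi :> R.
Proof. by rewrite gtrN// pi_gt0. Qed.

Definition tcons (n : nat) (x : measurableTypeR R * n.-tuple (measurableTypeR R))
  : n.+1.-tuple (measurableTypeR R) := [tuple of x.1 :: x.2].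

Lemma measurable_tcons (n : nat) : measurable_fun setT (@tcons n).
Proof. exact: measurable_cons. Qed.

HB.instance Definition _ (n : nat) :=
  isMeasurableFun.Build _ _ _ _ (@tcons n) (@measurable_tcons n).

(* The normalised Lebesgue measure (2 pi)^-n d^n k on [-pi, pi]^n, as the n-fold
   product of the uniform distribution on [-pi, pi]. *)
Fixpoint dk (n : nat) : probability (n.-tuple (measurableTypeR R)) R :=
  match n with
  | 0 => @dirac _ _ [tuple] R
  | n'.+1 => distribution
      (product_measure1 (uniform_prob ltNpipi) (dk n'))%E (@tcons n')
  end.

Definition row_of (d : nat) (t : d.-tuple (measurableTypeR R)) : 'rV[R]_d :=
  \row_i tnth t i.

Definition pnorm (d : nat) (p : R) (h : 'rV[R]_d -> R) : \bar R :=
  Lnorm (dk d) p%:E (fun t => (h (row_of t))%:E).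

(* Unordered sum of an absolutely summable family over Z^d. *)
Definition sumZ (d : nat) (h : 'rV[int]_d -> R) : R :=
  fine (esum [set: 'rV[int]_d] (EFin \o h)^\+ -
        esum [set: 'rV[int]_d] (EFin \o h)^\-)%E.

(* The derivative of h at z relative to [0, +oo[: the ordinary one if 0 < z,
   the right derivative if z = 0 (negative z carry no meaning). *)
Definition is_dz (h : R -> R) (z l : R) : Prop :=
  (h (z + t) - h z) / t @[t --> within [set t | 0 <= z + t] 0^'] --> l.

End Momentum.

Section Model.
Context {R : realType} {d : nat}.
Variables (theta pstar eps : R) (B : set R).
(* f L n k z, g L n k z, e L n k z and D L x *)
Variables (f g e : R -> nat -> 'rV[R]_d -> R -> R) (D : R -> 'rV[int]_d -> R).

Definition beta (L : R) : R := L `^ (- (d%:R / pstar)).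

Definition recursion : Prop := forall L, 1 <= L -> forall z : R, 0 < z ->
  forall k, box k ->
  f L 0 k z = 1 /\
  forall n : nat, f L n.+1 k z =
    \sum_(1 <= m < n.+2) g L m k z * f L (n.+1 - m) k z + e L n.+1 k z.

(* e^(i k.x) = cos (k.x) + i sin (k.x) *)
Definition Dhat (L : R) (k : 'rV[R]_d) : R[i] :=
  Complex (sumZ (fun x => cos (dotZ k x) * D L x))
          (sumZ (fun x => sin (dotZ k x) * D L x)).

(* Under assumptionD, Dhat is real: there f L 1 k z, which is real, equals
   z times Dhat. *)
Definition rDhat (L : R) (k : 'rV[R]_d) : R := complex.Re (Dhat L k).

Definition a (L : R) (k : 'rV[R]_d) : R := 1 - rDhat L k.

Definition sigma2 (L : R) : R := sumZ (fun x => sqnZ x * D L x).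

Definition assumptionS : Prop := forall L, 1 <= L ->
  [/\ forall z : R, 0 < z ->
        (forall n, lattice_symmetric (fun k => f L n k z)) /\
        (forall n, (1 <= n)%N ->
           lattice_symmetric (fun k => e L n k z) /\
           lattice_symmetric (fun k => g L n k z)),
      forall n, exists M : R,
        \forall z \near (1 : R), forall k, box k -> `|f L n k z| <= M
    & forall z : R, 0 < z ->
        (forall n, C2_near0 (fun k => f L n k z)) /\
        (forall n, (1 <= n)%N -> C2_near0 (fun k => g L n k z))].

Definition assumptionD : Prop :=
  [/\ forall L, 1 <= L ->
        [/\ forall x, 0 <= D L x,
            forall (z : R) k, 0 < z -> box k ->
              Complex (f L 1 k z) 0 = Complex z 0 * Dhat L k
          & forall (z : R) k, 0 < z -> box k -> e L 1 k z = 0],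
      0 < eps < theta - 2 /\
      (forall L, 1 <= L ->
         Dhat L 0 = 1 /\
         (\esum_(x in [set: 'rV[int]_d])
            (Num.sqrt (sqnZ x) `^ (2 + 2 * eps) * D L x)%:E < +oo)%E),
      exists C : R, forall L, 1 <= L ->
        (forall x, `|D L x| <= C * L `^ (- d%:R)) /\ sigma2 L <= C * L ^+ 2
    & exists eta c1 c2 : R, [/\ 0 < eta, 0 < c1, 0 < c2 &
        forall L, 1 <= L -> forall k, box k ->
          [/\ `|k| <= L^-1 ->
                c1 * L ^+ 2 * sqn k <= a L k <= c2 * L ^+ 2 * sqn k,
              L^-1 <= `|k| -> eta < a L k
            & a L k < 2 - eta]]].

Definition boundsF (K L : R) (m : nat) (z : R) : Prop :=
  [/\ forall p, B p ->
        (pnorm p (fun k => rDhat L k ^+ 2 * f L m k z)%R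
           <= (K / (L `^ (d%:R / p) *
                    m%:R `^ Num.min (d%:R / (2 * p)) theta))%:E)%E,
      `|f L m 0 z| <= K
    & `|laplacian (fun k => f L m k z) 0| <= K * sigma2 L * m%:R].

Definition boundsE (C L : R) (m : nat) (z : R) : Prop :=
  forall k, box k ->
    `|e L m k z| <= C * beta L * m%:R `^ (- theta) /\
    `|e L m k z - e L m 0 z| <= C * a L k * beta L * m%:R `^ (- theta + 1).

Definition boundsG (C L : R) (m : nat) (z : R) : Prop :=
  let lap := laplacian (fun k => g L m k z) 0 in
  [/\ forall k, box k -> `|g L m k z| <= C * beta L * m%:R `^ (- theta),
      `|lap| <= C * sigma2 L * beta L * m%:R `^ (- theta + 1),
      exists2 l : R, is_dz (fun z' => g L m 0 z') z l &
        `|l| <= C * beta L * m%:R `^ (- theta + 1)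
    & forall k, box k -> forall eps', 0 <= eps' <= eps ->
        `|g L m k z - g L m 0 z - a L k * (sigma2 L)^-1 * lap|
          <= C * beta L * a L k `^ (1 + eps') *
             m%:R `^ (- theta + (1 + eps'))].

Definition inductive_bounds (bounds : R -> R -> nat -> R -> Prop) : Prop :=
  exists (L0 alpha : R) (I : interval R) (C : R -> R),
    [/\ 0 < alpha < 1,
        [set` I] `<=` `[1 - alpha, 1 + alpha]
      & forall K L z (n : nat), 1 < K -> 1 <= L -> L0 <= L -> z \in I ->
          (forall m, (1 <= m <= n)%N -> boundsF K L m z) ->
          forall m, (2 <= m <= n.+1)%N -> bounds (C K) L m z].

Definition assumptionE : Prop := inductive_bounds boundsE.

Definition assumptionG : Prop := inductive_bounds boundsG.

(* For n = 0 the sum is empty, so that z_1 = 1. *)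
Fixpoint zseq (L : R) (n : nat) : R :=
  if n is n'.+1 then 1 - \sum_(2 <= m < n'.+2) g L m 0 (zseq L n') else 1.

Definition zcrit (L : R) : R := limn (zseq L).

Definition Iseq (K1 L : R) (n : nat) : set R :=
  let r := K1 * beta L * n%:R `^ (- theta + 1) in
  `[zseq L n - r, zseq L n + r].

(* The properties with which z_c is given, for L large; the constants K1 and K
   do not depend on L. *)
Definition critical_value : Prop :=
  exists K1 K Lc : R, 0 < K /\ forall L, 1 <= L -> Lc <= L ->
    [/\ forall n, (1 <= n)%N -> Iseq K1 L n.+1 `<=` Iseq K1 L n,
        \bigcap_(n in [set n | (1 <= n)%N]) Iseq K1 L n = [set zcrit L] /\
        zseq L n @[n --> \oo] --> zcrit L,
        \sum_(1 <= m < n) g L m 0 (zcrit L) @[n --> \oo] --> (1 : R),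
        exists2 A : R, 0 < A & f L n 0 (zcrit L) @[n --> \oo] --> A
      & forall m, (1 <= m)%N -> boundsF K L m (zcrit L)].

Definition chi (L z : R) : R := limn (series (fun n => f L n 0 z)).

Definition susceptibility_diverges_at (L zc' : R) : Prop :=
  [/\ 0 < zc',
      forall z : R, 0 < z < zc' -> cvgn (series (fun n => `|f L n 0 z|))
    & chi L z @[z --> zc'^'-] --> +oo].

(* The functions Ce and Cg of K are meant not to depend on L. *)
Definition uniform_bounds (Ce Cg : R -> R) (L : R) : Prop :=
  forall K, 1 < K ->
    (forall m, (1 <= m)%N -> boundsF K L m (zcrit L)) ->
    forall z : R, 0 <= z <= zcrit L -> forall m, (2 <= m)%N ->
      boundsE (Ce K) L m z /\ boundsG (Cg K) L m z.

End Model.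

(* Main.v *)
Require Import Defs.
From mathcomp Require Import all_boot all_order all_algebra.
From mathcomp Require Import all_classical all_reals all_analysis.
From mathcomp Require Import zify ring lra.

(** Only k = 0 matters; write f_n(z), g_n(z), e_n(z) for the values there.
    Summing the recursion over n, with G the sum of the g_m and E the sum of
    the e_m, gives the renewal identity

      chi(z) (1 - G(z)) = 1 + E(z)      for 0 < z < z_c' with z <= z_c

    ([renewal_generating], which rests on the Cauchy product of an absolutely
    convergent and a convergent series, [cvg_series_convolution]).

    - z_c' <= z_c: otherwise chi would converge at z_c, but its terms f_n(z_c)
      tend to A > 0.
    - z_c <= z_c': suppose z_c' < z_c. Since g_1(z) = z and the derivatives of
      the other g_m are at most C beta m^(1 - theta), which is summable because
      theta > 2 ([sum_powR_le]), for small beta the function G grows at slope at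
      least 1/2 on (0, z_c]. As G(z_c) = 1, this keeps 1 - G(z) above
      (z_c - z_c') / 2 for all z < z_c'. As E is bounded, the renewal identity
      then bounds chi from above on (0, z_c'), against its divergence at z_c'.

    [critical_point_eq] is this argument for scalar sequences of functions; the
    theorem feeds it the values at k = 0, with L so large that beta makes both
    z_c positive and the slope of G at least 1/2. *)

Import Order.TTheory GRing.Theory Num.Theory.
Import numFieldNormedType.Exports.

Local Open Scope classical_set_scope.
Local Open Scope ring_scope.

(** * Series and convolutions *)

Section Analysis.
Context {R : realType}.
Implicit Types (u v h : R^nat).

(** Telescoping: exp x >= 1 + x and ln (1 - 1/m) <= - 1/m give
    s m^(- 1 - s) <= (m - 1)^(- s) - m^(- s). *)
Lemma sum_powR_le (s : R) (n : nat) : 0 < s ->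
  \sum_(2 <= m < n) m%:R `^ (- (1 + s)) <= s^-1.
Proof.
move=> s0; rewrite -[leRHS]mul1r ler_pdivlMr// mulr_suml.
pose w (m : nat) : R := - m%:R `^ (- s).
apply: (@le_trans _ _ (\sum_(2 <= m < n) (w m - w m.-1))); last first.
  have [n2|n2] := leqP n 2; first by rewrite big_geq.
  case: n n2 => // n n2.
  rewrite big_add1 /= telescope_sumr// /w; last by lia.
  by rewrite (_ : 1%:R = 1)// powR1 opprK addrC lerBlDr lerDl powR_ge0.
rewrite big_nat [leRHS]big_nat; apply: ler_sum => m /andP[m2 _].
have m1 : (0 : R) < m%:R by rewrite ltr0n; lia.
have m1' : (0 : R) < m.-1%:R by rewrite ltr0n; lia.
rewrite /w opprK [leRHS]addrC lerBrDr /powR !gt_eqF//=.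
have -> : - (1 + s) * ln (m%:R : R) = - s * ln m%:R - ln m%:R by ring.
rewrite expRD expRN lnK ?posrE//.
have -> : - s * ln m.-1%:R = - s * ln m%:R + s * (ln m%:R - ln m.-1%:R) :> R.
  by ring.
rewrite expRD.
have -> : forall x y : R, x * y^-1 * s + x = x * (1 + s / y) by move=> x y; ring.
rewrite ler_wpM2l ?expR_ge0//.
apply: le_trans (expR_ge1Dx _); rewrite lerD2l.
apply: ler_wpM2l; first exact: ltW.
rewrite -lerN2 opprB.
rewrite -ln_div ?posrE//.
have -> : m.-1%:R / m%:R = 1 + (- m%:R^-1) :> R.
  by rewrite -subn1 natrB ?mulrBl ?divff ?mul1r ?gt_eqF//; lia.
by apply: le_ln1Dx; rewrite ltrN2 invf_lt1// ltr1n.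
Qed.

(** In the sum over k < n, the terms with k below a fixed index see h only far
    out, where it is small; the others are weighted by a small tail of u. *)
Lemma convolution_cvg0 u h : cvgn (series (fun k => `|u k|)) -> h @ \oo --> 0 ->
  (\sum_(0 <= k < n) u k * h (n - k)%N) @[n --> \oo] --> 0.
Proof.
move=> cu h0.
have nd : nondecreasing_seq (series (fun k => `|u k|)).
  by apply: nondecreasing_series => k _ _ /=.
have [H hH] : exists H, forall n, `|h n| <= H.
  have /cvg_seq_bounded [H [_ hH]] : cvgn h by apply/cvg_ex; exists 0.
  by exists (H + 1) => n; apply: hH => //; rewrite ltrDl.
have H0 : 0 <= H by apply: le_trans (hH 0%N).
set M := limn (series (fun k => `|u k|)).
have leM n : (series (fun k => `|u k|)) n <= M by exact: nondecreasing_cvgn_le.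
have M0 : 0 <= M by apply: le_trans (leM 0%N); rewrite seriesEnat /= big_geq.
apply/cvgr0Pnorm_le => e e0.
pose e' := e / (M + H + 1).
have e'0 : 0 < e' by rewrite divr_gt0// ltr_wpDl// addr_ge0.
have [n0 _ hn0] := (cvgr0Pnorm_le _).1 h0 _ e'0.
have [n1 _ /(_ n1 (leqnn _))/= hn1] := (cvgrPdist_le _ _).1 cu _ e'0.
exists (n0 + n1)%N => // n /= nn.
have n1n : (n1 <= n)%N by lia.
rewrite (big_cat_nat (n := n1))//=; apply: le_trans (ler_normD _ _) _.
apply: (@le_trans _ _ (M * e' + H * e')); last first.
  rewrite -mulrDl /e' mulrCA ler_piMr ?(ltW e0)//.
  by rewrite ler_pdivrMr ?mul1r ?lerDl// ltr_wpDl// addr_ge0.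
apply: lerD.
  apply: (@le_trans _ _ (\sum_(0 <= k < n1) `|u k| * e')).
    apply: le_trans (ler_norm_sum _ _ _) _.
    rewrite big_nat [leRHS]big_nat; apply: ler_sum => k /andP[_ kn1].
    by rewrite normrM ler_wpM2l// hn0//=; lia.
  rewrite -mulr_suml ler_wpM2r ?(ltW e'0)//.
  by have := leM n1; rewrite seriesEnat.
apply: (@le_trans _ _ (\sum_(n1 <= k < n) `|u k| * H)).
  apply: le_trans (ler_norm_sum _ _ _) _.
  by apply: ler_sum => k _; rewrite normrM ler_wpM2l.
rewrite -mulr_suml mulrC ler_wpM2l//.
have -> : \sum_(n1 <= k < n) `|u k| = (series (fun k => `|u k|)) n - (series (fun k => `|u k|)) n1.
  by rewrite sub_series_geq.
apply: le_trans hn1; rewrite ger0_norm ?lerB ?leM// ?subr_ge0 ?leM//.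
Qed.

(** Summation over the triangle i + j < n, with the second index summed first. *)
Lemma series_convolution u v n :
  series (fun n => \sum_(0 <= k < n.+1) u k * v (n - k)%N) n =
  \sum_(0 <= k < n) u k * series v (n - k)%N.
Proof.
elim: n => [|n ih]; first by rewrite seriesEnat /= !big_geq.
rewrite seriesSr ih [in X in _ + X]big_nat_recr//= [in RHS]big_nat_recr//=.
rewrite addrA -big_split/= subnn subSnn seriesEnat /= big_nat1; congr (_ + _).
rewrite !big_nat; apply: eq_bigr => k /andP[_ kn].
by rewrite -mulrDr subSn 1?ltnW// big_nat_recr.
Qed.

(** Mertens' theorem: the partial sums of v differ from their limit by a null
    sequence, to which [convolution_cvg0] applies. *)
Lemma cvg_series_convolution u v :
  cvgn (series (fun k => `|u k|)) -> cvgn (series v) ->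
  series (fun n => \sum_(0 <= k < n.+1) u k * v (n - k)%N) @ \oo -->
    limn (series u) * limn (series v).
Proof.
move=> cu cv.
have cv0 : (fun n => series v n - limn (series v)) @ \oo --> 0.
  by rewrite -(subrr (limn (series v))); apply: cvgB => //; exact: cvg_cst.
have -> : series (fun n => \sum_(0 <= k < n.+1) u k * v (n - k)%N) =
  (fun n => \sum_(0 <= k < n) u k * (series v (n - k)%N - limn (series v))) +
  (fun n => series u n * limn (series v)).
  apply/funext => n; rewrite series_convolution fctE seriesEnat /=.
  rewrite mulr_suml -big_split/=; apply: eq_bigr => k _; ring.
rewrite -[X in _ --> X]add0r; apply: cvgD; first exact: (convolution_cvg0 _ _ cu cv0).
by apply: cvgM; [exact: normed_cvg | exact: cvg_cst].
Qed.

Lemma series0nat u n : u 0%N = 0 -> series u n = \sum_(1 <= m < n) u m.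
Proof.
rewrite seriesEnat; case: n => [|n] u0 /=; first by rewrite !big_geq.
by rewrite big_ltn// u0 add0r.
Qed.

Lemma cvg_normed_series_powR u (c s : R) : 0 < s -> 0 <= c ->
  (forall m, (2 <= m)%N -> `|u m| <= c * m%:R `^ (- (1 + s))) ->
  cvgn (series (fun k => `|u k|)).
Proof.
move=> s0 c0 hu; apply: nondecreasing_is_cvgn.
  by apply: nondecreasing_series => k _ _ /=.
exists (`|u 0%N| + `|u 1%N| + c / s) => _ [n _ <-]; rewrite seriesEnat/=.
apply: (@le_trans _ _ (\sum_(0 <= k < n.+2) `|u k|)).
  by rewrite [leRHS](big_cat_nat (n := n))//= ?lerDl ?sumr_ge0//; lia.
rewrite big_ltn// big_ltn// addrA lerD2l.
apply: (@le_trans _ _ (c * \sum_(2 <= m < n.+2) m%:R `^ (- (1 + s)))).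
  rewrite mulr_sumr big_nat [leRHS]big_nat; apply: ler_sum => m /andP[m2 _].
  exact: hu.
by rewrite ler_wpM2l// sum_powR_le.
Qed.

(** * Lipschitz bounds from one-sided derivatives *)

(** Away from the origin the constraint 0 <= z + t holds for all small t. *)
Lemma is_dz_derivable (h : R -> R) (z l : R) : 0 < z -> is_dz h z l ->
  is_derive z 1 h l.
Proof.
move=> z0 hl.
have hc : t^-1 *: (h (t *: (1 : R) + z) - h z) @[t --> 0^'] --> l.
  have -> : (fun t : R => t^-1 *: (h (t *: (1 : R) + z) - h z)) =
            (fun t => (h (z + t) - h z) / t).
    by apply/funext => t; rewrite mulrC scaler1 [t + z]addrC.
  have pos : \forall t \near (0 : R)^', 0 <= z + t.
    apply: nbhs_dnbhs; exists z => //= t; rewrite /ball/= sub0r normrN.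
    by rewrite ltr_norml; lra.
  move=> A /hl hA; apply: filterS2 pos hA => t zt; exact.
by split; [apply/cvg_ex; exists l | exact: cvg_lim hc].
Qed.

Lemma is_dz_lipschitz (h : R -> R) (c x y : R) : 0 < x -> x <= y ->
  (forall z, x <= z <= y -> exists2 l, is_dz h z l & `|l| <= c) ->
  `|h y - h x| <= c * (y - x).
Proof.
move=> x0; rewrite le_eqVlt => /predU1P[->|xy] hdz.
  by rewrite !subrr normr0 mulr0.
have dh z : x <= z <= y -> derivable h z 1 /\ `|derive1 h z| <= c.
  move=> zxy; have [l /(is_dz_derivable _ _ _) hl lc] := hdz z zxy.
  have {}hl := hl (lt_le_trans x0 (proj1 (andP zxy))).
  by rewrite derive1E derive_val; split.
have [z| |z zxy ->] := @MVT R h (derive1 h) x y xy.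
- rewrite in_itv/= => /andP[xz zy]; have [|dhz _] := dh z; first by rewrite !ltW.
  by apply: DeriveDef => //; rewrite derive1E.
- by apply: derivable_within_continuous => z; rewrite in_itv/= => /dh[].
rewrite normrM (gtr0_norm (_ : 0 < y - x)) ?subr_gt0//.
apply: ler_wpM2r; first by rewrite subr_ge0 ltW.
by move: zxy; rewrite in_itv/= => /andP[xz zy]; apply: (dh z _).2; rewrite !ltW.
Qed.

End Analysis.

(** * The renewal equation and its critical point *)

Section Renewal.
Context {R : realType}.

(** With g 0 = e 0 = 0 the recursion reads f = delta_0 + g * f + e; summing it
    turns the convolution into a product. *)
Lemma renewal_generating (f g e : R^nat) :
  f 0%N = 1 -> g 0%N = 0 -> e 0%N = 0 ->
  (forall n, f n.+1 = \sum_(1 <= m < n.+2) g m * f (n.+1 - m)%N + e n.+1) ->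
  cvgn (series f) -> cvgn (series (fun m => `|g m|)) -> cvgn (series e) ->
  limn (series f) * (1 - limn (series g)) = 1 + limn (series e).
Proof.
move=> f0 g0 e0 frec cf cg ce.
pose conv n := \sum_(0 <= k < n.+1) g k * f (n - k)%N.
have fE n : series f n.+1 = 1 + (series conv n.+1 + series e n.+1).
  elim: n => [|n ih].
    by rewrite !seriesEnat /= !big_nat1 /conv big_nat1 subnn f0 g0 e0; ring.
  rewrite [LHS]seriesSr ih [series conv n.+2]seriesSr [series e n.+2]seriesSr.
  rewrite frec [conv n.+1]big_ltn// g0; ring.
have := cvg_series_convolution _ _ cg cf; rewrite -/conv => cconv.
have lim1 : series f n.+1 @[n --> \oo] --> limn (series f).
  by rewrite (cvg_shiftS (series f)).
have lim2 : series f n.+1 @[n --> \oo] -->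
    1 + (limn (series g) * limn (series f) + limn (series e)).
  under eq_fun do rewrite fE.
  apply: cvgD; first exact: cvg_cst.
  by apply: cvgD; [rewrite (cvg_shiftS (series conv))
                  | rewrite (cvg_shiftS (series e))].
by rewrite mulrBr mulr1 {1}(norm_cvg_unique lim1 lim2); ring.
Qed.

(** Here 1 + s is theta - 1, the exponent in the derivative bound, and c and ce
    carry the factor beta. The condition c / s <= 1/2 makes the sum of the
    derivatives of g_m over m >= 2 at most half the derivative 1 of g_1. *)
Lemma critical_point_eq (f g e : nat -> R -> R) (s c ce zc zc' A : R) :
  0 < s -> 0 <= c -> 0 <= ce -> c / s <= 2^-1 -> 0 < zc -> 0 < zc' ->
  (forall z, 0 < z -> [/\ f 0%N z = 1, g 1%N z = z, e 1%N z = 0 &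
     forall n, f n.+1 z =
       \sum_(1 <= m < n.+2) g m z * f (n.+1 - m)%N z + e n.+1 z]) ->
  (forall z m, 0 < z <= zc -> (2 <= m)%N ->
     [/\ `|e m z| <= ce * m%:R `^ (- (1 + s)),
         `|g m z| <= c * m%:R `^ (- (1 + s)) &
         exists2 l, is_dz (g m) z l & `|l| <= c * m%:R `^ (- (1 + s))]) ->
  \sum_(1 <= m < n) g m zc @[n --> \oo] --> (1 : R) ->
  0 < A -> f n zc @[n --> \oo] --> A ->
  (forall z, 0 < z < zc' -> cvgn (series (fun n => `|f n z|))) ->
  limn (series (fun n => f n z)) @[z --> zc'^'-] --> +oo ->
  zc = zc'.
Proof.
move=> s0 c0 ce0 cs zc0 zc'0 hrec hbnd hgzc A0 hA hsum hchi.
apply/eqP; rewrite eq_le; apply/andP; split; last first.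
  rewrite leNgt; apply/negP => zczc'.
  have /hsum/normed_cvg/cvg_series_cvg_0 f0 : 0 < zc < zc' by rewrite zc0.
  by have A_eq0 : A = 0 := norm_cvg_unique hA f0; move: A0; rewrite A_eq0 ltxx.
rewrite leNgt; apply/negP => zc'zc.
pose delta := (zc - zc') / 2.
have delta0 : 0 < delta by rewrite divr_gt0// subr_gt0.
pose M := ce / s.
have M0 : 0 <= M by rewrite divr_ge0// ltW.
(* chi exceeds the bound that the renewal identity will impose on it. *)
have [z [zpos zzc' chiz]] : exists z,
    [/\ 0 < z, z < zc' & (1 + M) / delta < limn (series (fun n => f n z))].
  have : \forall z \near zc'^'-, [/\ 0 < z, z < zc' &
      (1 + M) / delta < limn (series (fun n => f n z))].
    near=> z; split; near: z.
    - exact: nbhs_left_gt.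
    - exact: nbhs_left_lt.
    - by move/cvgryPgt : hchi; apply.
  by move=> /filter_ex[z hz]; exists z.
have zzc : z < zc by exact: lt_trans zc'zc.
have zin : 0 < z <= zc by rewrite zpos ltW.
(* g and e carry no meaning at index 0; extending them by 0 makes the sums from
   m = 1 into full series. *)
pose gz m := if m is 0%N then 0 else g m z.
pose ez m := if m is 0%N then 0 else e m z.
have [f0 g1 e1 frec] := hrec z zpos.
have cg : cvgn (series (fun m => `|gz m|)).
  apply: (cvg_normed_series_powR _ _ _ s0 c0) => -[//|m] m2.
  by have [] := hbnd z m.+1 zin m2.
have ce' : cvgn (series (fun m => `|ez m|)).
  apply: (cvg_normed_series_powR _ _ _ s0 ce0) => -[//|m] m2.
  by have [] := hbnd z m.+1 zin m2.
have gen : limn (series (fun n => f n z)) * (1 - limn (series gz)) =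
           1 + limn (series ez).
  apply: renewal_generating => //; last exact: normed_cvg.
  - move=> n; rewrite frec; congr (_ + _).
    by rewrite !big_nat; apply: eq_bigr => -[|m].
  - by apply: normed_cvg; apply: hsum; rewrite zpos.
have E_le : limn (series ez) <= M.
  apply: limr_le; first exact: normed_cvg.
  near=> n; rewrite series0nat//.
  have n2 : (2 <= n)%N by near: n; exists 2%N.
  rewrite big_ltn//= e1 add0r.
  apply: (@le_trans _ _ (ce * \sum_(2 <= m < n) m%:R `^ (- (1 + s)))).
    rewrite mulr_sumr big_nat [leRHS]big_nat; apply: ler_sum => -[//|m] /andP[m2 _].
    by apply: le_trans (ler_norm _) _; have [] := hbnd z m.+1 zin m2.
  by rewrite ler_wpM2l// sum_powR_le.
(* 1 - G(z) = G(z_c) - G(z), compared on partial sums. *)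
have G_le : delta <= 1 - limn (series gz).
  have hlim : (\sum_(1 <= m < n) g m zc - series gz n) @[n --> \oo] -->
      1 - limn (series gz).
    by apply: cvgB => //; exact: normed_cvg.
  rewrite -(cvg_lim _ hlim)//; apply: limr_ge; first by apply/cvg_ex; eexists; exact: hlim.
  near=> n; rewrite series0nat//.
  have n2 : (2 <= n)%N by near: n; exists 2%N.
  rewrite big_ltn// [X in _ - X]big_ltn//= g1.
  have [_ -> _ _] := hrec zc zc0.
  rewrite opprD addrACA.
  have : `|\sum_(2 <= m < n) g m zc - \sum_(2 <= m < n) gz m| <= (zc - z) / 2.
    rewrite -sumrB; apply: le_trans (ler_norm_sum _ _ _) _.
    apply: (@le_trans _ _ (c * (\sum_(2 <= m < n) m%:R `^ (- (1 + s))) * (zc - z))).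
      rewrite mulr_sumr mulr_suml big_nat [leRHS]big_nat.
      apply: ler_sum => -[//|m] /andP[m2 _].
      apply: is_dz_lipschitz; rewrite ?(ltW zzc)// => y /andP[zy yzc].
      by have [] := hbnd y m.+1 _ m2; rewrite // (lt_le_trans zpos zy).
    rewrite mulrC; apply: ler_wpM2l; first by rewrite subr_ge0 ltW.
    by apply: le_trans cs; rewrite ler_wpM2l// sum_powR_le.
  by rewrite ler_norml /delta => /andP[]; move: zzc'; lra.
have chi0 : 0 <= (1 + M) / delta by rewrite divr_ge0 ?addr_ge0// ltW.
have : 1 + M < 1 + M.
  apply: (@lt_le_trans _ _ (limn (series (fun n => f n z)) * delta)).
    by rewrite -ltr_pdivrMr.
  apply: (@le_trans _ _ (1 + limn (series ez))); last by rewrite lerD2l.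
  rewrite -gen; apply: ler_wpM2l => //; exact: le_trans (ltW chiz).
by rewrite ltxx.
Unshelve. all: by end_near. Qed.

End Renewal.

(** * Facts about the model *)

Section ModelFacts.
Context {R : realType} {d : nat}.

(** For the Laplacian bound one needs 0 <= sigma2 L * m; this follows from the
    bound with the constant K > 0 itself. *)
Lemma boundsF_le (theta : R) (B : set R) (f : R -> nat -> 'rV[R]_d -> R -> R)
    (D : R -> 'rV[int]_d -> R) (K K' L : R) (m : nat) (z : R) :
  0 < K -> K <= K' ->
  boundsF theta B f D K L m z -> boundsF theta B f D K' L m z.
Proof.
move=> K0 KK' [hp h0 hlap]; split.
- move=> p Bp; apply: le_trans (hp p Bp) _; rewrite lee_fin.
  by rewrite ler_wpM2r// invr_ge0 mulr_ge0 ?powR_ge0.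
- exact: le_trans KK'.
- apply: le_trans (hlap) _; rewrite -!mulrA ler_wpM2r//.
  by have := le_trans (normr_ge0 _) hlap; rewrite -mulrA pmulr_rge0.
Qed.

(** beta = L^(-d/pstar) tends to 0 as L grows. *)
Lemma beta_small (pstar X : R) : (0 < d)%N -> 0 < pstar -> 0 < X ->
  exists L0, forall L, 1 <= L -> L0 <= L -> X * beta (d := d) pstar L <= 1.
Proof.
move=> d0 p0 X0; exists (X `^ (pstar / d%:R)) => L L1 XL.
have dp : 0 < d%:R / pstar by rewrite divr_gt0// ltr0n.
rewrite /beta powRN -ler_pdivlMr ?invr_gt0 ?powR_gt0 ?(lt_le_trans ltr01)//.
rewrite invrK mul1r.
have <- : (X `^ (pstar / d%:R)) `^ (d%:R / pstar) = X.
  rewrite -powRrM (_ : _ * _ = 1) ?powRr1 ?ltW//.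
  by rewrite -invf_div mulVf// gt_eqF.
by apply: ge0_ler_powR => //; rewrite ?ltW// ?nnegrE ?powR_ge0// (le_trans ler01).
Qed.

Lemma box0 : box (0 : 'rV[R]_d).
Proof. by move=> i; rewrite mxE lerNl oppr0 pi_ge0. Qed.

End ModelFacts.

Theorem theorem2p2 (R : realType) (d : nat) (dc : R) (theta : nat -> R)
    (pstar eps : R) (B : set R)
    (f g e : R -> nat -> 'rV[R]_d -> R -> R) (D : R -> 'rV[int]_d -> R)
    (hd : (0 < d)%N) (hdc : dc < d%:R) (htheta : 2 < theta d)
    (hpstar : 1 <= pstar) (hB0 : B !=set0) (hB : B `<=` `[1, pstar])
    (hrec : recursion f g e)
    (hS : assumptionS f g e)
    (hD : assumptionD (theta d) eps f e D)
    (hE : assumptionE (theta d) pstar B f e D)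
    (hG : assumptionG (theta d) pstar eps B f g D)
    (hzc : critical_value (theta d) pstar B f g D)
    (Ce Cg : R -> R) :
  exists L1 : R, forall L : R, 1 <= L -> L1 <= L ->
    forall zc' : R,
      susceptibility_diverges_at f L zc' ->
      uniform_bounds (theta d) pstar eps B f g e D Ce Cg L ->
      zcrit g L = zc'.
Proof.
have [K1 [K [Lc [K0 hcrit]]]] := hzc.
(* The bounds on e and g are available for constants above 1 only. *)
pose K' := Num.max K 2.
pose s := theta d - 2.
have s0 : 0 < s by rewrite subr_gt0.
have p0 : 0 < pstar by exact: lt_le_trans hpstar.
(* One smallness condition on beta serves both the radius of I_1 and the slope
   of G. *)
have [|L0 hL0] := beta_small (d := d) _ (2 * (`|K1| + `|Cg K'| / s + 1)) hd p0.
  by rewrite mulr_gt0// ltr_wpDl// addr_ge0// divr_ge0// ltW.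
exists (Num.max Lc L0) => L L1; rewrite ge_max => /andP[LLc LL0] zc'.
move=> [zc'0 hsum hchi] hunif.
have [_ [hI _] hg1 [A A0 hA] hF] := hcrit L L1 LLc.
have b0 : 0 < beta (d := d) pstar L by rewrite powR_gt0// (lt_le_trans ltr01).
have {hL0} := hL0 L L1 LL0; rewrite -mulrA => hb.
have Cs0 : 0 <= `|Cg K'| / s by rewrite divr_ge0// ltW.
have K1b : `|K1| * beta (d := d) pstar L <= 2^-1.
  have := mulr_ge0 Cs0 (ltW b0); move: hb; rewrite 2!mulrDl; lra.
have Cgb : `|Cg K'| * beta (d := d) pstar L / s <= 2^-1.
  rewrite mulrAC; have := mulr_ge0 (normr_ge0 K1) (ltW b0).
  by move: hb; rewrite 2!mulrDl; lra.
(* I_1 is centred at z_1 = 1 with radius K1 beta <= 1/2. *)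
have zc0 : 0 < zcrit g L.
  have : Iseq (theta d) pstar g K1 L 1 (zcrit g L).
    have : [set zcrit g L] (zcrit g L) by [].
    by rewrite -hI; apply.
  rewrite /Iseq /= powR1 mulr1 big_geq// subr0 in_itv/= => /andP[+ _].
  have := ler_wpM2r (ltW b0) (ler_norm K1); lra.
have hFK m : (1 <= m)%N -> boundsF (theta d) B f D K' L m (zcrit g L).
  by move=> /hF; apply: boundsF_le => //; rewrite le_max lexx.
have {}hunif := hunif K' _ hFK.
have powle m : (2 <= m)%N -> m%:R `^ (- theta d) <= m%:R `^ (- (1 + s)) :> R.
  move=> m2; apply: ler_powR; first by rewrite ler1n ltnW.
  by rewrite /s; lra.
have [hDL _ _ _] := hD.
have [_ hf1 he1] := hDL L L1.
have [_ [_ /(_ L L1)[Dhat0 _]] _ _] := hD.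
apply: (critical_point_eq (fun n z => f L n 0 z) (fun n z => g L n 0 z)
  (fun n z => e L n 0 z) s (`|Cg K'| * beta (d := d) pstar L)
  (`|Ce K'| * beta (d := d) pstar L) _ _ A) => //.
- by rewrite mulr_ge0// ltW.
- by rewrite mulr_ge0// ltW.
- move=> z z0; have [f0 fS] := hrec L L1 z z0 0 box0.
  have e1 : e L 1 0 z = 0 by apply: he1 => //; exact: box0.
  split=> //.
  have := fS 0%N; rewrite big_nat1 subnn f0 mulr1 e1 addr0 => <-.
  have /(congr1 (@complex.Re R)) := hf1 z 0 z0 box0.
  by rewrite Dhat0 mulr1.
- move=> z m /andP[z0 zzc] m2.
  have K'1 : 1 < K' by rewrite lt_max ltr1n orbT.
  have z_in : 0 <= z <= zcrit g L by rewrite (ltW z0) zzc.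
  have [hbE [hbG _ [l hl lb] _]] := hunif K'1 z z_in m m2.
  have cle (x C E t : R) : `|x| <= C * beta (d := d) pstar L * E ->
      0 <= E -> E <= t -> `|x| <= `|C| * beta (d := d) pstar L * t.
    move=> xC E0 Et; apply: le_trans xC _.
    apply: (@le_trans _ _ (`|C| * beta (d := d) pstar L * E)).
      by rewrite ler_wpM2r// ler_wpM2r ?ler_norm// ltW.
    by rewrite ler_wpM2l// mulr_ge0// ltW.
  split.
  + by apply: cle (powR_ge0 _ _) (powle m m2); have [] := hbE 0 box0.
  + by apply: cle (powR_ge0 _ _) (powle m m2); exact: hbG box0.
  + exists l => //; apply: cle lb (powR_ge0 _ _) _.
    by rewrite (_ : - (1 + s) = - theta d + 1)// /s; lra.
Qed.
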